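(* Let $X$ be a locally compact zero-dimensional space, let $S \subseteq \mathrm{Homeo}(X)$ with $1 \in S$ and $S = S^{-1}$, such that $S$ is equicontinuous with respect to some compatible uniformity on $X$, and let $G = \langle S \rangle$. Let $U$ be an open subset of $X$, and write $U^*$ for the union of all compact $G$-invariant subsets of $U$. Then the following are equivalent: (i) $U^*$ is open in $X$ and consists of $S$-recurrent points. (ii) $U^*$ is open in $X$ and consists of almost periodic points for $G$. (iii) For every compact open subset $V$ of $U$, the intersection $\bigcap_{g \in G} g(V)$ is open. (iv) Given $x \in U$ and $y \in U^*$ such that $y \in \overline{Gx}$, then $x \in \overline{Gy}$. (v) There is an open neighbourhood $W$ of $U^*$ such that the $G$-orbit closure relation restricted to $W \times W$ is closed (as a subset of $W \times W$). (vi) $U^*$ is open in $X$ and there is a $G$-equivariant quotient map $\phi: U^* \rightarrow Y$, where $Y$ is a locally compact zero-dimensional space such that $G$ acts trivially on $Y$ and minimally on each fibre of $\phi$.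
   Context: A locally compact space is zero-dimensional if it is Hausdorff and has a base consisting of clopen sets. $\mathrm{Homeo}(X)$ is the group of homeomorphisms of $X$; $Gx = \{gx \mid g \in G\}$; the bar denotes closure in $X$. A subset $A \subseteq X$ is $G$-invariant if $gA = A$ for all $g \in G$. Equicontinuity: $S$ is equicontinuous at $x \in X$ with respect to a uniformity $\mathcal{U}$ compatible with the topology of $X$ if for every entourage $E \in \mathcal{U}$ there is a neighbourhood $N$ of $x$ such that $(sx,sy) \in E$ for all $s \in S$ and $y \in N$; $S$ is equicontinuous if it is equicontinuous at every point of $X$. Word length: for $g \in G$, $|g|$ is the word length of $g$ with respect to the generating set $S$. $S^n$ is the set of products of at most $n$ elements of $S$. For $g \in G$, $K(g) = S^{|g|-1}g = \{hg \mid h \in G, |h| < |g|\}$. $S$-recurrence: $x \in X$ is $S$-recurrent if for every net $(g_i)_{i \in I}$ in $G$ such that $|g_i| \rightarrow \infty$ and every neighbourhood $N$ of $x$, there is an integer $n$, a subnet $(g_{i(j)})_{j \in J}$ and elements $c_j \in K(g_{i(j)})$ $(j \in J)$ such that $c_j x \in N$ and $|c_j| \le n$ for all $j \in J$. Almost periodicity: $x \in X$ is almost periodic for $G$ if for every neighbourhood $N$ of $x$, letting $M = \{h \in G \mid hx \in N\}$, there is a finite subset $F$ of $G$ such that $FM = G$. The $G$-orbit closure relation is $R = \{(x,y) \in X \times X \mid y \in \overline{Gx}\}$. An action of $G$ on a topological space is minimal if every orbit is dense. *)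

(* Defs.v *)
From HB Require Import structures.
From mathcomp Require Import all_boot all_order all_algebra.
From mathcomp Require Import all_classical all_reals all_analysis.

Set Implicit Arguments.
Unset Strict Implicit.
Unset Printing Implicit Defensive.

Local Open Scope classical_set_scope.
Local Open Scope group_scope.

(* [zero_dimensional] of the library only says that clopen sets separate
   points, hence the explicit clopen base. *)
Definition locally_compact_zero_dimensional (X : topologicalType) : Prop :=
  [/\ locally_compact [set: X], hausdorff_space X
    & exists2 B : set (set X), B `<=` clopen & basis B].

(* A uniformity inducing the topology of X: the axioms of [uniformType] on X,
   whose topology is already fixed. *)
Definition compatible_uniformity (X : topologicalType)
    (E : set_system (X * X)) : Prop :=
  [/\ Filter E,
      forall A, E A -> diagonal `<=` A,
      forall A, E A -> E (A^-1)%relation,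
      forall A, E A -> exists2 B, E B & (B \; B)%relation `<=` A
    & forall x : X, nbhs x = nbhs_ E x].

Section Homeo.
Context (X : topologicalType).

Record homeo := Homeo {
  homeo_fun :> X -> X;
  homeo_inv : X -> X;
  homeoK : cancel homeo_fun homeo_inv;
  homeoVK : cancel homeo_inv homeo_fun;
  homeo_continuous : continuous homeo_fun;
  homeo_inv_continuous : continuous homeo_inv }.

Lemma homeo_ext (f g : homeo) : f =1 g -> f = g.
Proof.
case: f g => [f f' fK fVK cf cf'] [g g' gK gVK cg cg'] /= /funext fg.
subst g.
have fg' : f' = g' by apply/funext => y; rewrite -[y in LHS]gVK fK.
by subst g'; congr Homeo; exact: Prop_irrelevance.
Qed.

Definition homeo_id : homeo :=
  @Homeo idfun idfun (fun=> erefl) (fun=> erefl) (fun x => @cvg_id _ (nbhs x))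
    (fun x => @cvg_id _ (nbhs x)).

Definition homeo_comp (f g : homeo) : homeo :=
  @Homeo (f \o g) (homeo_inv g \o homeo_inv f)
    (can_comp (@homeoK f) (@homeoK g)) (can_comp (@homeoVK g) (@homeoVK f))
    (fun x => continuous_comp (@homeo_continuous g x)
                (@homeo_continuous f (g x)))
    (fun x => continuous_comp (@homeo_inv_continuous f x)
                (@homeo_inv_continuous g (homeo_inv f x))).

Definition homeo_opp (f : homeo) : homeo :=
  Homeo (@homeoVK f) (@homeoK f) (@homeo_inv_continuous f)
    (@homeo_continuous f).

Lemma homeo_compA : associative homeo_comp.
Proof. by move=> f g h; exact: homeo_ext. Qed.
Lemma homeo_comp1f : left_id homeo_id homeo_comp.
Proof. by move=> f; exact: homeo_ext. Qed.
Lemma homeo_compf1 : right_id homeo_id homeo_comp.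
Proof. by move=> f; exact: homeo_ext. Qed.
Lemma homeo_compVf : left_inverse homeo_id homeo_opp homeo_comp.
Proof. by move=> f; apply: homeo_ext; exact: homeoK. Qed.
Lemma homeo_compfV : right_inverse homeo_id homeo_opp homeo_comp.
Proof. by move=> f; apply: homeo_ext; exact: homeoVK. Qed.

HB.instance Definition _ := gen_eqMixin homeo.
HB.instance Definition _ := gen_choiceMixin homeo.
(* (f * g) x = f (g x): Homeo(X) acts on X from the left. *)
HB.instance Definition _ := isGroup.Build homeo homeo_compA homeo_comp1f
  homeo_compf1 homeo_compVf homeo_compfV.

End Homeo.

Section WordLength.
Context (gT : groupType) (S : set gT).

Definition subgroup (H : set gT) : Prop :=
  [/\ H 1, forall x y, H x -> H y -> H (x * y) & forall x, H x -> H x^-1].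

Definition subgroup_generated : set gT := smallest subgroup S.

Definition word_ball (n : nat) : set gT :=
  [set \prod_(s <- w) s | w in
    [set w : seq gT | (size w <= n)%N /\ forall s, s \in w -> S s]].

(* Junk value 0 when g is not a product of elements of S. *)
Definition word_length (g : gT) : nat :=
  xget 0%N [set n | word_ball n g /\ forall m, word_ball m g -> (n <= m)%N].

Definition K_set (g : gT) : set gT :=
  [set h * g | h in
    [set h | subgroup_generated h /\ (word_length h < word_length g)%N]].

End WordLength.

Section Nets.
Context (I : Type) (le : I -> I -> Prop).

Definition directed_preorder : Prop :=
  [/\ inhabited I, forall i, le i i,
      forall i j k, le i j -> le j k -> le i k
    & forall i j, exists2 k, le i k & le j k].

(* A net g : I -> T converges along le iff g @ tails converges. *)
Definition tails : set_system I := filter_from setT (fun i => [set j | le i j]).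

End Nets.

Section Actions.
Context (X : topologicalType).
Implicit Types (S G : set (homeo X)) (A U W : set X).

Definition equicontinuous_wrt (E : set_system (X * X)) S : Prop :=
  forall (x : X) (A : set (X * X)), E A ->
    \forall y \near x, forall s, S s -> A (s x, s y).

Definition action_orbit G (x : X) : set X := [set g x | g in G].

Definition invariant_set G A : Prop := forall g, G g -> [set g x | x in A] = A.

(* U^*, the union of the compact G-invariant subsets of U. *)
Definition compact_core G U : set X :=
  \bigcup_(K in [set K | [/\ compact K, invariant_set G K & K `<=` U]]) K.

(* h @ tails leJ --> tails leI says that g \o h is a subnet of g (in Kelley's
   sense: h need not be monotone). *)
Definition S_recurrent S (x : X) : Prop :=
  forall (I : Type) (leI : I -> I -> Prop) (g : I -> homeo X),
    directed_preorder leI -> (forall i, subgroup_generated S (g i)) ->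
    word_length S (g i) @[i --> tails leI] --> \oo ->
  forall N : set X, nbhs x N ->
  exists (n : nat) (J : Type) (leJ : J -> J -> Prop) (h : J -> I),
    [/\ directed_preorder leJ, h j @[j --> tails leJ] --> tails leI
      & exists c : J -> homeo X, forall j,
          [/\ K_set S (g (h j)) (c j), N (c j x)
            & (word_length S (c j) <= n)%N]].

Definition almost_periodic G (x : X) : Prop :=
  forall N : set X, nbhs x N ->
  exists F : set (homeo X), [/\ finite_set F, F `<=` G
    & [set f * m | f in F & m in [set h | G h /\ N (h x)]] = G].

Definition orbit_closure_rel G (x y : X) : Prop := closure (action_orbit G x) y.

(* Minimality of the action of G on the subspace A (A is meant to be
   G-invariant). *)
Definition minimal_on G A : Prop :=
  forall x : A, dense [set y : A | action_orbit G (set_val x) (set_val y)].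

Definition trivial_action (Y : Type) (g : homeo X) (y : Y) : Y := y.

(* gx is the point g x of A: it exists when A is G-invariant, as is the case
   of A = U^* by [compact_core_invariant]. *)
Definition equivariant_map G A (Y : Type) (act : homeo X -> Y -> Y)
    (phi : A -> Y) : Prop :=
  forall (g : homeo X) (x gx : A),
    G g -> set_val gx = g (set_val x) -> phi gx = act g (phi x).

Lemma compact_core_invariant G U : invariant_set G (compact_core G U).
Proof.
move=> g Gg; rewrite image_bigcup; apply: eq_bigcupr => K [_ Kinv _].
exact: Kinv.
Qed.

End Actions.

Definition quotient_map (T Y : topologicalType) (phi : T -> Y) : Prop :=
  range phi = [set: Y] /\ forall V : set Y, open V <-> open (phi @^-1` V).

(* Main.v *)
Require Import Defs.
From mathcomp Require Import all_boot all_order all_algebra.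
From mathcomp Require Import all_classical all_reals all_analysis.

Local Open Scope classical_set_scope.
Local Open Scope group_scope.

(* Everything reduces to (iv), the symmetry of the orbit closure relation. The
   only hard step is (iv) => (iii). For V compact open put V_0 = V and let
   V_(n+1) be the intersection of the s(V_n), s in S; by equicontinuity V_n is
   compact open, and the intersection V_oo of the V_n is the largest invariant
   subset of V. If V_oo is not open, the points where a path starting close to
   V_oo leaves V accumulate at some z in V \ V_oo whose orbit closure meets
   V_oo, contradicting (iv). For (i) => (iv), equicontinuity along compact
   invariant sets and S-recurrence show that a compact open subset L of U^* has
   bounded return times, so that G L is the union of the g(L) with |g| <= n, and
   this union contains the closure of every orbit in U^* that meets L. *)

(** * Compactness through directed covers and nested closed sets *)

Lemma compact_directed_cover {T : topologicalType} {I : Type} (D : set I)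
    (f : I -> set T) (K : set T) :
  compact K -> D !=set0 ->
  (forall i j, D i -> D j -> exists2 k, D k & f i `|` f j `<=` f k) ->
  (forall i, D i -> open (f i)) -> K `<=` \bigcup_(i in D) f i ->
  exists2 i, D i & K `<=` f i.
Proof.
move=> /compact_near_coveringP cK D0 Ddir fop Kf.
(* The filter of tails for inclusion of the [f i]: by directedness, a property near [F] holds for
   all large enough members, so near covering gives one member containing [K]. *)
pose F := filter_from D (fun i => [set j | D j /\ f i `<=` f j]).
have FF : Filter F.
  apply: filter_from_filter => // i j Di Dj.
  have [k Dk fk] := Ddir i j Di Dj; exists k => // l [Dl kl].
  by split; split => //; apply: subset_trans kl; apply: subset_trans fk => ? ?;
    [left|right].
have [x Kx|i Di] := cK I F (fun i x => f i x) FF.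
  have [i Di fix_] := Kf x Kx.
  exists (f i, [set j | D j /\ f i `<=` f j]); first split.
  - by apply: open_nbhs_nbhs; split; [exact: fop|].
  - by exists i.
  - by move=> [y j] [/= fy [_ ij]]; exact: ij.
by move=> Ki; exists i => //; apply: Ki; split.
Qed.

Lemma compact_decreasing_bigcap {T : topologicalType} (K : set T)
    (F : nat -> set T) :
  compact K -> (forall n, closed (F n)) -> (forall n, F n.+1 `<=` F n) ->
  (forall n, K `&` F n !=set0) -> K `&` \bigcap_n F n !=set0.
Proof.
move=> cK Fcl Fdec FN0; apply/set0P/eqP => KF0.
have Fmono m n : (m <= n)%N -> F n `<=` F m.
  elim: n => [|n IH]; first by rewrite leqn0 => /eqP ->.
  by rewrite leq_eqVlt => /predU1P[->//|/IH]; exact: subset_trans.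
have [] := @compact_directed_cover _ _ setT (fun n => ~` F n) K cK.
- by exists 0%N.
- move=> m n _ _; exists (maxn m n) => // x [Fx|Fx] Fmx; apply: Fx;
    by apply: Fmono Fmx; rewrite (leq_maxl, leq_maxr).
- by move=> n _; apply: closed_openC; exact: Fcl.
- move=> x Kx; apply: contrapT => nx.
  suff : (K `&` \bigcap_n F n) x by rewrite KF0.
  by split => // n _; apply: contrapT => Fx; apply: nx; exists n.
- by move=> n _ KFn; have [x [Kx Fx]] := FN0 n; exact: KFn Fx.
Qed.

(** * Compact open sets in zero-dimensional spaces *)

Section ZeroDimensional.
Context {X : topologicalType}.
Hypothesis Xlczd : locally_compact_zero_dimensional X.

Lemma lczd_compact_closed (A : set X) : compact A -> closed A.
Proof. by case: Xlczd => _ hX _; exact: compact_closed. Qed.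

Lemma compact_open_nbhs (x : X) (N : set X) : nbhs x N ->
  exists L : set X, [/\ compact L, open L, L x & L `<=` N].
Proof.
case: Xlczd => lcX _ [B Bclopen [_ Bbasis]] Nx.
have [C + [Ccpt Ccl]] := lcX x I.
rewrite withinET => Cx.
have [L [BL Lx] LNC] := Bbasis x _ (filterI Nx Cx).
have [oL cL] := Bclopen L BL.
exists L; split => //.
  by apply: subclosed_compact cL Ccpt _ => y /LNC [].
by move=> y /LNC [].
Qed.

(** The compact open subsets of [O] are directed under union and cover [K]. *)
Lemma compact_open_between (K O : set X) : compact K -> open O -> K `<=` O ->
  exists V : set X, [/\ compact V, open V, K `<=` V & V `<=` O].
Proof.
move=> cK oO KO.
have [] := @compact_directed_cover X _
  [set V : set X | [/\ compact V, open V & V `<=` O]] id K cK.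
- by exists set0; split; [exact: compact0|exact: open0|exact: sub0set].
- move=> V W [cV oV VO] [cW oW WO]; exists (V `|` W) => //.
  by split; [exact: compactU|exact: openU|rewrite subUset].
- by move=> V [].
- move=> x Kx; have [|V [cV oV Vx VO]] := @compact_open_nbhs x O.
    by apply: open_nbhs_nbhs; split; [|exact: KO].
  by exists V.
- by move=> V [cV oV VO] KV; exists V.
Qed.

End ZeroDimensional.

(** * Entourages and compact sets *)

Section CompatibleUniformity.
Context {X : topologicalType} {E : set_system (X * X)}.
Hypothesis EX : compatible_uniformity E.

Lemma entourage_nbhs (x : X) (A : set (X * X)) :
  E A -> nbhs x [set y | A (x, y)].
Proof.
move=> EA; case: EX => _ _ _ _ ->; exists A => // y.
by move=> /xsectionP.
Qed.

Lemma nbhs_entourage_ex (x : X) (N : set X) :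
  nbhs x N -> exists2 A, E A & forall y, A (x, y) -> N y.
Proof.
case: EX => _ _ _ _ -> [A EA AN]; exists A => // y Axy.
by apply: AN; apply/xsectionP.
Qed.

(* A Lebesgue number lemma, for the partition into classes of [Q]. *)
Lemma compact_equivalence_entourage (K : set X) (Q : X -> X -> Prop) :
  compact K -> (forall x y, Q x y -> Q y x) ->
  (forall x y z, Q x y -> Q y z -> Q x z) ->
  (forall x, K x -> \forall y \near x, Q x y) ->
  exists2 B, E B & forall x y, K x -> B (x, y) -> Q x y.
Proof.
move=> /compact_near_coveringP cK Qsym Qtrans KQ.
have EF : Filter E by case: EX.
pose F := filter_from E (fun A => [set W | E W /\ W `<=` A]).
have FF : Filter F.
  apply: filter_from_filter; first by exists setT; exact: filterT.
  move=> A B EA EB; exists (A `&` B); first exact: filterI.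
  by move=> W [EW]; rewrite subsetI => -[].
have [x Kx|W EW KW] := cK _ F
    (fun (W : set (X * X)) x => forall y, W (x, y) -> Q x y) FF.
  have [A EA AQ] := nbhs_entourage_ex _ _ (KQ x Kx).
  (* If y is [C]-close to x and z is [C]-close to y, both are [A]-close to x, so [Q y z] follows
     through x. *)
  have [C EC CA] : exists2 B, E B & (B \; B)%relation `<=` A.
    by case: EX => _ _ _ /(_ A EA).
  have EdC : forall y, C (y, y).
    by move=> y; case: EX => _ /(_ C EC) dC _ _ _; apply: dC.
  exists ([set y | C (x, y)], [set W | E W /\ W `<=` C]).
    by split => /=; [exact: entourage_nbhs|exists C].
  move=> [y W] [/= Cxy [_ WC]] z /WC Cyz.
  apply: (Qtrans _ x); first by apply/Qsym/AQ/CA; exists y.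
  by apply/AQ/CA; exists y.
exists W => // x y Kx; exact: (KW W (conj EW (fun p Wp => Wp)) x Kx).
Qed.

End CompatibleUniformity.

(** * Word balls and word length *)

Section WordBalls.
Context {gT : groupType} {S : set gT}.
Local Notation G := (subgroup_generated S).
Local Notation ball := (word_ball S).
Local Notation len := (word_length S).

Lemma subgroup_generated_subgroup : subgroup G.
Proof.
split=> [H [[]]//|x y Gx Gy H|x Gx H] HS; have [[H1 HM HV] SH] := HS.
- by apply: HM; [apply: Gx|apply: Gy].
- by apply: HV; apply: Gx.
Qed.

Lemma subgroup_generated1 : G 1.
Proof. by case: subgroup_generated_subgroup. Qed.

Lemma subgroup_generatedM {g h : gT} : G g -> G h -> G (g * h).
Proof. by case: subgroup_generated_subgroup => _ + _; exact. Qed.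

Lemma subgroup_generatedV {g : gT} : G g -> G g^-1.
Proof. by case: subgroup_generated_subgroup => _ _; exact. Qed.

Lemma word_ball1 (n : nat) : ball n 1.
Proof. by exists [::]; rewrite ?big_nil. Qed.

Lemma word_ball_gen (s : gT) : S s -> ball 1 s.
Proof.
move=> Ss; exists [:: s]; last by rewrite big_seq1.
by split => // t; rewrite inE => /eqP ->.
Qed.

Lemma word_ball_le {m n : nat} : (m <= n)%N -> ball m `<=` ball n.
Proof.
by move=> mn _ [w [wm wS] <-]; exists w => //; split => //; exact: leq_trans mn.
Qed.

Lemma word_ballM (m n : nat) (g h : gT) :
  ball m g -> ball n h -> ball (m + n) (g * h).
Proof.
move=> [v [vm vS] <-] [w [wn wS] <-]; exists (v ++ w); last by rewrite big_cat.
split; first by rewrite size_cat leq_add.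
by move=> s; rewrite mem_cat => /orP[/vS|/wS].
Qed.

Lemma word_ball_split {m n : nat} {g : gT} : ball (m + n) g ->
  exists g1 g2, [/\ g = g1 * g2, ball m g1 & ball n g2].
Proof.
move=> [w [wmn wS] <-].
exists (\prod_(s <- take m w) s), (\prod_(s <- drop m w) s); split.
- by rewrite -big_cat cat_take_drop.
- exists (take m w) => //; split; first by rewrite size_take_min geq_minl.
  by move=> s /mem_take/wS.
- exists (drop m w) => //; split; first by rewrite size_drop leq_subLR.
  by move=> s /mem_drop/wS.
Qed.

Lemma word_ball_sub (n : nat) : ball n `<=` G.
Proof.
move=> _ [w [_ wS] <-]; rewrite big_seq.
elim/big_ind: _ => [|g h|s /wS Ss]; first exact: subgroup_generated1.
- exact: subgroup_generatedM.
- exact: sub_gen_smallest.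
Qed.

Hypothesis SV : forall s, S s -> S s^-1.

Lemma word_ballV {n : nat} {g : gT} : ball n g -> ball n g^-1.
Proof.
move=> [w [+ wS] <-]; elim: w n wS => [|s w IH] n wS /=.
  by rewrite big_nil invg1 => _; exact: word_ball1.
case: n => // n wn; rewrite big_cons invgM -addn1; apply: word_ballM.
  by apply: IH => // t tw; apply: wS; rewrite inE tw orbT.
by apply/word_ball_gen/SV/wS; rewrite inE eqxx.
Qed.

Lemma subgroup_generatedE : G = \bigcup_n ball n.
Proof.
apply/seteqP; split; last by move=> g [n _ /word_ball_sub].
apply: smallest_sub => [|s Ss]; last by exists 1%N => //; exact: word_ball_gen.
split=> [|g h [m _ mg] [n _ nh]|g [n _ ng]].
- by exists 0%N => //; exact: word_ball1.
- by exists (m + n)%N => //; exact: word_ballM.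
- by exists n => //; exact: word_ballV.
Qed.

(** As [S] is symmetric, the balls exhaust [G]; the minimum exists and the default value 0 of
    [word_length] does not intervene. *)
Lemma word_length_least (g : gT) : G g ->
  ball (len g) g /\ forall m, ball m g -> (len g <= m)%N.
Proof.
rewrite subgroup_generatedE => -[n _ ng].
have exg : exists n, `[<ball n g>] by exists n; exact/asboolP.
apply: (@xgetPex _ 0%N
  [set k | ball k g /\ forall m, ball m g -> (k <= m)%N]).
case: (ex_minnP exg) => k /asboolP kg kmin; exists k; split => // m mg.
by apply: kmin; exact/asboolP.
Qed.

Lemma word_length_ball {g : gT} : G g -> ball (len g) g.
Proof. by case/word_length_least. Qed.

Lemma word_length_le {n : nat} {g : gT} : ball n g -> (len g <= n)%N.
Proof.
by move=> ng; have [_] := word_length_least g (word_ball_sub _ _ ng); exact.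
Qed.

End WordBalls.

(** * Orbit closures, invariant parts and the compact core *)

Lemma closureNP {X : topologicalType} (A : set X) (x : X) :
  locally_compact_zero_dimensional X -> ~ closure A x ->
  exists N : set X, [/\ compact N, open N, N x & forall z, A z -> ~ N z].
Proof.
move=> Xlczd /existsNP[B /not_implyP[Bx AB0]].
have [N [cN oN Nx NB]] := compact_open_nbhs Xlczd x B Bx.
by exists N; split => // z Az /NB Bz; apply: AB0; exists z.
Qed.

Section Orbits.
Context {X : topologicalType} {S : set (homeo X)}.
Local Notation G := (subgroup_generated S).
Implicit Types (x y z : X) (g : homeo X).

Lemma homeo_mulK g : cancel g (g^-1)%g.
Proof. exact: homeoK. Qed.

Lemma homeo_mulVK g : cancel (g^-1)%g g.
Proof. exact: homeoVK. Qed.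

Lemma nbhs_homeo x g (N : set X) : nbhs (g x) N -> nbhs x [set y | N (g y)].
Proof. exact: homeo_continuous. Qed.

Lemma action_orbitM x g : G g -> action_orbit G (g x) = action_orbit G x.
Proof.
move=> Gg; apply/seteqP; split=> _ [h Gh <-].
  by exists (h * g) => //; exact: subgroup_generatedM.
exists (h * g^-1).
  by apply: subgroup_generatedM => //; exact: subgroup_generatedV.
exact: (congr1 h (homeo_mulK g x)).
Qed.

Lemma orbit_closure_refl x : closure (action_orbit G x) x.
Proof.
by apply: subset_closure; exists 1 => //; exact: subgroup_generated1.
Qed.

Lemma orbit_closure_orbit x g : G g -> closure (action_orbit G x) (g x).
Proof. by move=> Gg; apply: subset_closure; exists g. Qed.

Lemma orbit_closure_trans x y z : closure (action_orbit G x) y ->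
  closure (action_orbit G y) z -> closure (action_orbit G x) z.
Proof.
move=> xy yz N Nz; move: (Nz); rewrite nbhsE => -[W [Wop Wz] WN].
have [_ [[g Gg <-] Wgy]] := yz _ (open_nbhs_nbhs (conj Wop Wz)).
have [_ [[h Gh <-] Wghx]] :=
  xy _ (nbhs_homeo y g _ (open_nbhs_nbhs (conj Wop Wgy))).
exists (g (h x)); split; last exact: WN.
by exists (g * h) => //; exact: subgroup_generatedM.
Qed.

Lemma invariant_setP (K : set X) : invariant_set G K <->
  forall x g, G g -> K x -> K (g x).
Proof.
split=> [Kinv x g Gg Kx|Kinv g Gg]; first by rewrite -(Kinv g Gg); exists x.
apply/seteqP; split=> [_ [x Kx <-]|x Kx]; first exact: Kinv.
exists (g^-1 x); last exact: homeo_mulVK.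
by apply: Kinv => //; exact: subgroup_generatedV.
Qed.

Lemma orbit_closure_sub (K : set X) x : closed K -> invariant_set G K -> K x ->
  closure (action_orbit G x) `<=` K.
Proof.
move=> clK /invariant_setP Kinv Kx.
rewrite [X in _ `<=` X](closure_id K).1 //; apply: closureS => _ [g Gg <-].
exact: Kinv.
Qed.

Lemma compact_core_sub (U : set X) : compact_core G U `<=` U.
Proof. by move=> x [K [_ _ KU] /KU]. Qed.

Lemma compact_coreM (U : set X) x g :
  G g -> compact_core G U x -> compact_core G U (g x).
Proof.
move=> Gg; move: x g Gg; apply/invariant_setP; exact: compact_core_invariant.
Qed.

Lemma compact_coreMP (U : set X) x g :
  G g -> compact_core G U (g x) -> compact_core G U x.
Proof.
move=> Gg /(compact_coreM U _ _ (subgroup_generatedV Gg)).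
by rewrite homeo_mulK.
Qed.

(** The largest invariant subset of [V], which is the intersection in (iii) by [invariant_partE]. *)
Definition invariant_part (V : set X) : set X :=
  [set x | forall g, G g -> V (g x)].

Lemma invariant_partE (V : set X) :
  \bigcap_(g in G) [set g x | x in V] = invariant_part V.
Proof.
apply/seteqP; split=> x Vx g Gg.
  have [y Vy <-] := Vx _ (subgroup_generatedV Gg).
  by rewrite homeo_mulVK.
exists (g^-1 x); last exact: homeo_mulVK.
exact: Vx _ (subgroup_generatedV Gg).
Qed.

Lemma invariant_part_sub (V : set X) : invariant_part V `<=` V.
Proof. by move=> x /(_ 1 subgroup_generated1). Qed.

Lemma invariant_part_invariant (V : set X) : invariant_set G (invariant_part V).
Proof.
apply/invariant_setP => x g Gg Vx h Gh.
by apply: (Vx (h * g)); exact: subgroup_generatedM.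
Qed.

Lemma sub_invariant_part (K V : set X) : invariant_set G K -> K `<=` V ->
  K `<=` invariant_part V.
Proof. by move=> /invariant_setP Kinv KV x Kx g Gg; exact/KV/Kinv. Qed.

Lemma invariant_part_closed (V : set X) : closed V -> closed (invariant_part V).
Proof.
move=> clV x clx g Gg; apply: clV => N /(nbhs_homeo x) /clx[y [Vy Ngy]].
by exists (g y); split => //; exact: Vy.
Qed.

Lemma invariant_part_compact (V : set X) : closed V -> compact V ->
  compact (invariant_part V).
Proof.
move=> clV cV; apply: subclosed_compact cV (@invariant_part_sub V).
exact: invariant_part_closed.
Qed.

Lemma invariant_part_core (U V : set X) : closed V -> compact V -> V `<=` U ->
  invariant_part V `<=` compact_core G U.
Proof.
move=> clV cV VU x Vx; exists (invariant_part V) => //; split.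
- exact: invariant_part_compact.
- exact: invariant_part_invariant.
- exact: subset_trans (@invariant_part_sub V) VU.
Qed.

Lemma compact_coreP (U : set X) x :
  locally_compact_zero_dimensional X -> open U -> compact_core G U x ->
  exists V, [/\ compact V, open V, V `<=` U & invariant_part V x].
Proof.
move=> Xlczd oU [K [cK Kinv KU] Kx].
have [V [cV oV KV VU]] := compact_open_between Xlczd K U cK oU KU.
by exists V; split => //; exact: sub_invariant_part Kx.
Qed.

End Orbits.

(** * Recurrence and almost periodicity *)

Section Recurrence.
Context {X : topologicalType} {S : set (homeo X)}.
Local Notation G := (subgroup_generated S).
Local Notation ball := (word_ball S).
Local Notation len := (word_length S).
Hypothesis SV : forall s, S s -> S s^-1.

(** Nets disappear: the bound n can be chosen for all g at once, since otherwise counterexamples for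
    n = 0, 1, 2, ... form a net with lengths tending to infinity. *)
Lemma S_recurrentP (x : X) : S_recurrent S x <->
  forall N, nbhs x N -> exists n, forall g, G g -> (n <= len g)%N ->
    exists c, [/\ K_set S g c, N (c x) & (len c <= n)%N].
Proof.
split=> [xrec N Nx|xrec I leI g dirI Gg glen N Nx].
  apply: contrapT => /forallNP bad.
  have {}bad n : exists g, [/\ G g, (n <= len g)%N & forall c,
      K_set S g c -> N (c x) -> ~ (len c <= n)%N].
    have /existsNP[g /not_implyP[Gg /not_implyP[ng gbad]]] := bad n.
    exists g; split => // c Kc Nc cn; apply: gbad; by exists c.
  have /choice[g gP] := bad.
  have [|||n [J [leJ [h [[[j0] leJxx leJt leJd] hcvg [c cP]]]]]] :=
    xrec nat (fun m n => (m <= n)%N : Prop) g _ _ _ N Nx.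
  - split=> // [|m p k|m p]; first by constructor; exact: 0%N.
      exact: leq_trans.
    by exists (maxn m p); rewrite (leq_maxl, leq_maxr).
  - by move=> n; case: (gP n).
  - move=> A [m _ mA]; exists m => // n /= mn; apply: mA => /=.
    by apply: leq_trans mn _; case: (gP n).
  (* Far enough in the subnet, the index [h j] exceeds the bound n, contrary to the choice of
     [g (h j)]. *)
  have [|j _ jh] := hcvg [set m | (n <= m)%N]; first by exists n.
  have := jh j (leJxx j) => /= njh.
  have [Kc Nc cn] := cP j.
  by case: (gP (h j)) => _ _ /(_ _ Kc Nc); apply; exact: leq_trans njh.
have [_ leIxx leIt leId] := dirI.
have [n nP] := xrec N Nx.
(* The subnet is indexed by [I] itself, moving each i to a later index at which the length is at
   least n. *)
have {}nP : forall i, exists hi, [/\ leI i hi & exists c, [/\ K_set S (g hi) c,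
    N (c x) & (len c <= n)%N]].
  move=> i; have [|i0 _ i0P] := glen [set k | (n <= k)%N]; first by exists n.
  have [k ik i0k] := leId i i0; exists k; split => //.
  by apply: nP => //; exact: i0P.
have /choice[h hP] := nP.
have /choice[c cP] : forall i, exists c,
    [/\ K_set S (g (h i)) c, N (c x) & (len c <= n)%N].
  by move=> i; case: (hP i).
exists n, I, leI, h; split=> //.
  move=> A [i _ iA]; exists i => // j ij; apply: iA => /=.
  by apply: leIt ij _; case: (hP j).
by exists c.
Qed.

(** Writing g = f m with f in [F] and m x in [N], the inverse of f returns g x to [N]; n is the
    largest length in [F]. *)
Lemma almost_periodic_bounded_return (x : X) : almost_periodic G x ->
  forall N, nbhs x N ->
  exists n, forall g, G g -> exists2 h, ball n h & N (h (g x)).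
Proof.
move=> xap N /xap[F [/finite_seqP[A FA] FG FM]].
exists (\max_(f <- A) len f) => g; rewrite -FM => -[f Ff [m [_ Nm] <-]].
exists f^-1; last by rewrite -[(f * m) x]/(f (m x)) homeo_mulK.
apply: (word_ballV SV); apply: word_ball_le (word_length_ball SV (FG _ Ff)).
by apply: leq_bigmax_seq => //; move: Ff; rewrite FA.
Qed.

Lemma almost_periodic_S_recurrent (x : X) :
  almost_periodic G x -> S_recurrent S x.
Proof.
move=> xap; apply/S_recurrentP => N Nx.
have [n nP] := almost_periodic_bounded_return x xap N Nx.
(* Cut g = g1 g2 with g2 of length at most n + 1, and return g2 x to [N] by f of length at most n.
   Then f g2 = (f g1^-1) g has length at most n + (n + 1), and f g1^-1 has length at most n + (|g| -
   n - 1) < |g|. *)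
exists (n + n.+1)%N => g Gg glen.
have gn : (n.+1 <= len g)%N by apply: leq_trans glen; rewrite leq_addl.
have := word_length_ball SV Gg; rewrite -{1}(subnK gn).
move=> /word_ball_split[g1 [g2 [gE g1b g2b]]].
have [f fb Nf] := nP g2 (word_ball_sub _ _ g2b).
exists (f * g2); split => //; last exact/(word_length_le SV)/word_ballM.
have fg1 := word_ballM _ _ _ _ fb (word_ballV SV g1b).
exists (f * g1^-1); last by rewrite gE mulgA mulgVK.
split; first exact: word_ball_sub fg1.
rewrite /=; apply: leq_ltn_trans (word_length_le SV fg1) _.
by rewrite -[ltnRHS](subnK gn) addnC ltn_add2l.
Qed.

End Recurrence.

(** * Consequences of equicontinuity of the generators *)

Section EquicontinuousGenerators.
Context {X : topologicalType} {S : set (homeo X)} {E : set_system (X * X)}.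
Hypothesis Xlczd : locally_compact_zero_dimensional X.
Hypothesis S1 : S 1.
Hypothesis SV : forall s, S s -> S s^-1.
Hypothesis EX : compatible_uniformity E.
Hypothesis ES : equicontinuous_wrt E S.
Local Notation G := (subgroup_generated S).
Local Notation ball := (word_ball S).
Local Notation len := (word_length S).

Lemma word_ball0P (g : homeo X) : ball 0 g -> g = 1.
Proof. by move=> [w [+ _] <-]; rewrite leqn0 => /nilP ->; rewrite big_nil. Qed.

Lemma word_ball1P (g : homeo X) : ball 1 g -> S g.
Proof.
move=> [w [+ wS] <-]; case: w wS => [|s [|t w]] wS //.
  by rewrite big_nil.
by move=> _; rewrite big_seq1; apply: wS; rewrite inE.
Qed.

(** The Lebesgue entourage controls only pairs starting in [L]. Intersecting it with its inverse
    also covers pairs ending in [L], so the complement of [L] may fail to be compact. *)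
Lemma compact_open_entourage (L : set X) : compact L -> open L ->
  exists2 B, E B & forall x y, B (x, y) -> (L x <-> L y).
Proof.
move=> cL oL.
have [B EB BL] := compact_equivalence_entourage EX L (fun x y => L x <-> L y) cL
  (fun x y => @iff_sym _ _) (fun x y z => @iff_trans _ _ _)
  (fun x Lx => filterS (fun y Ly => conj (fun=> Ly) (fun=> Lx))
    (open_nbhs_nbhs (conj oL Lx))).
have EF : Filter E by case: EX.
exists (B `&` (B^-1)%relation).
  by apply: filterI => //; case: EX => _ _ + _ _; exact.
move=> x y [/= Bxy Byx]; split=> [Lx|Ly]; first exact: (BL x y Lx Bxy).1.
exact: (BL y x Ly Byx).1.
Qed.

Lemma near_generators (L : set X) (x : X) : compact L -> open L ->
  \forall y \near x, forall s, S s -> (L (s x) <-> L (s y)).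
Proof.
move=> cL oL; have [B EB BL] := compact_open_entourage L cL oL.
by apply: filterS (ES x B EB) => y Bxy s Ss; exact/BL/Bxy.
Qed.

(** Such a [P] is locally constant by [near_generators]. *)
Lemma clopen_generators (L P : set X) : compact L -> open L ->
  (forall x y, (forall s, S s -> (L (s x) <-> L (s y))) -> P x -> P y) ->
  clopen P.
Proof.
move=> cL oL LP; split.
  rewrite openE => x Px; apply: filterS (near_generators L x cL oL) => y xy.
  exact: LP xy Px.
move=> x clP; have [y [Py xy]] := clP _ (near_generators L x cL oL).
by apply: LP Py => s Ss; exact: iff_sym (xy s Ss).
Qed.

(* Equicontinuity of S at the points of K would not pass to products without
   the compactness and the invariance of K. *)
Lemma near_word_ball (K L : set X) (n : nat) : compact K -> invariant_set G K ->
  compact L -> open L ->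
  forall x, K x ->
  \forall y \near x, forall c, ball n c -> (L (c x) <-> L (c y)).
Proof.
move=> cK /invariant_setP Kinv cL oL; elim: n => [|n IH] x Kx.
  apply: filterS (near_generators L x cL oL) => y xy c /word_ball0P ->.
  exact: xy.
(* A word of length n + 1 is c1 s with s in [S]. The entourage [B] handles c1 uniformly along [K],
   which contains s x, and equicontinuity makes s x and s y [B]-close. *)
have [||B EB BL] := compact_equivalence_entourage EX K
  (fun x y => forall c, ball n c -> (L (c x) <-> L (c y))) cK _ _ IH.
- by move=> u v uv c nc; apply: iff_sym; exact: uv.
- by move=> u v w uv vw c nc; apply: iff_trans (vw c nc); exact: uv.
apply: filterS (ES x B EB) => y xy c; rewrite -addn1 => /word_ball_split.
move=> [c1 [s [-> c1n /[dup] /word_ball1P Ss /word_ball_sub Gs]]].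
exact: BL (Kinv x s Gs Kx) (xy s Ss) c1 c1n.
Qed.

Lemma compact_core_near_word_ball (U L : set X) (n : nat) (x : X) :
  compact_core G U x -> compact L -> open L ->
  \forall y \near x, forall c, ball n c -> (L (c x) <-> L (c y)).
Proof.
by move=> [K [cK Kinv _] Kx] cL oL; exact: near_word_ball cK Kinv cL oL x Kx.
Qed.

(** A shortest word h returning g x to [L] cannot be long: recurrence at h g x, applied to h^-1,
    yields f h^-1 with f shorter than h and f g x in [L]. Compactness of [L] makes the recurrence
    bound uniform. *)
Lemma S_recurrent_uniform_return (U L : set X) : compact L -> open L ->
  L `<=` compact_core G U -> (forall x, L x -> S_recurrent S x) ->
  exists n, forall x g, L x -> G g -> exists2 h, ball n h & L (h (g x)).
Proof.
move=> cL oL LU Lrec.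
(* The same n serves as threshold and as bound, so that [R] increases with n. *)
pose R n := [set y : X | forall g, G g -> (n <= len g)%N ->
  exists c, [/\ K_set S g c, L (c y) & (len c <= n)%N]].
have [|m n _ _|n _|x Lx|n _ Ln] :=
    @compact_directed_cover X nat setT (fun n => interior (R n)) L cL.
- by exists 0%N.
- have Rle k l : (k <= l)%N -> interior (R k) `<=` interior (R l).
    move=> kl; apply: interiorS => x Rx g Gg lg.
    have [c [Kc Lc ck]] := Rx g Gg (leq_trans kl lg).
    by exists c; split => //; exact: leq_trans kl.
  by exists (maxn m n) => // x [|]; apply: Rle; rewrite (leq_maxl, leq_maxr).
- exact: open_interior.
- have [n nP] := (S_recurrentP x).1 (Lrec x Lx) L (open_nbhs_nbhs (conj oL Lx)).
  exists n => //.
  (* Only words c of length at most n occur, and for these membership of c x in [L] is unchanged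
     near x. *)
  apply: filterS (compact_core_near_word_ball U L n x (LU x Lx) cL oL).
  move=> y xy g Gg ng.
  have [c [Kc Lcx cn]] := nP g Gg ng; exists c; split => //; apply/xy => //.
  apply: word_ball_le cn _ _; apply: (word_length_ball SV).
  by case: Kc => h [Gh _] <-; exact: subgroup_generatedM.
exists n => x g Lx Gg; pose z := g x.
have exk : exists k, `[<exists2 h, ball k h & L (h z)>].
  exists (len g^-1); apply/asboolP; exists g^-1.
    by apply: (word_length_ball SV); exact: subgroup_generatedV.
  by rewrite /z homeo_mulK.
case: (ex_minnP exk) => k /asboolP[h kh Lhz] kmin.
have [nk|kn] := leqP n k; last first.
  by exists h => //; exact: word_ball_le (ltnW kn) _ kh.
have Gh := word_ball_sub _ _ kh.
have lenh : len h^-1 = k.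
  apply/eqP; rewrite eqn_leq (word_length_le SV (word_ballV SV kh)) /=.
  apply: kmin; apply/asboolP; exists h => //.
  have := word_ballV SV (word_length_ball SV (subgroup_generatedV Gh)).
  by rewrite invgK.
have [|_ [[f [Gf flt] <-] Lf _]] :=
  interior_subset (Ln _ Lhz) h^-1 (subgroup_generatedV Gh).
  by rewrite lenh.
move: Lf; rewrite -[_ (h z)]/(f (h^-1 (h z))) homeo_mulK => Lfz.
have : (k <= len f)%N.
  by apply: kmin; apply/asboolP; exists f => //; exact: word_length_ball.
by rewrite leqNgt -lenh flt.
Qed.

(** For symmetric [S], the intersection of the s(A), hence the passage from V_n to V_(n+1). *)
Definition generator_inter (A : set X) := [set x | forall s, S s -> A (s x)].

(** The points of [V] one generator away from [A]; iterating it follows paths that stay in [V]. *)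
Definition generator_union (V A : set X) :=
  V `&` [set x | exists2 s, S s & A (s x)].

Lemma generator_inter_sub (A : set X) : generator_inter A `<=` A.
Proof. by move=> x /(_ 1 S1). Qed.

Lemma generator_inter_clopen (A : set X) : compact A -> open A ->
  clopen (generator_inter A).
Proof.
move=> cA oA; apply: (clopen_generators A) => // x y xy Ax s Ss.
exact: (xy s Ss).1 (Ax s Ss).
Qed.

Lemma generator_union_clopen (V A : set X) : clopen V ->
  compact A -> open A -> clopen (generator_union V A).
Proof.
move=> Vclopen cA oA; apply: clopenI => //.
apply: (clopen_generators A) => // x y xy [s Ss As]; exists s => //.
exact: (xy s Ss).1 As.
Qed.

Lemma generator_union_mono (V A B : set X) : A `<=` B ->
  generator_union V A `<=` generator_union V B.
Proof.
by move=> AB x [Vx [s Ss As]]; split => //; exists s => //; exact: AB.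
Qed.

Lemma generator_inter_invariant (A V : set X) : A `<=` generator_inter A ->
  A `<=` V -> A `<=` invariant_part (S := S) V.
Proof.
move=> AA AV x Ax g; rewrite (subgroup_generatedE SV) => -[n _ ng]; apply: AV.
elim: n g x ng Ax => [|n IH] g x; first by move=> /word_ball0P ->.
rewrite -addn1 => /word_ball_split[c [s [-> nc /word_ball1P Ss]]] Ax.
by apply: (IH c (s x) nc); exact: AA.
Qed.

Lemma generator_inter_iter (V : set X) (n : nat) : clopen V -> compact V ->
  [/\ clopen (iter n generator_inter V), compact (iter n generator_inter V)
    & iter n generator_inter V `<=` V].
Proof.
move=> Vclopen cV; elim: n => [|n [nclopen ncpt nV]] /=; first by split.
have [oI clI] := generator_inter_clopen _ ncpt nclopen.1.
split=> //; last by apply: subset_trans nV; exact: generator_inter_sub.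
exact: subclosed_compact ncpt (@generator_inter_sub _).
Qed.

(** Points of the n-th iterate stay in [V] under every word of length at most n. *)
Lemma bigcap_generator_inter_iter (V : set X) :
  \bigcap_n iter n generator_inter V `<=` invariant_part (S := S) V.
Proof.
move=> x Vx g; rewrite (subgroup_generatedE SV) => -[n _ ng].
have := Vx n I; elim: n g x {Vx} ng => [|n IH] g x.
  by move=> /word_ball0P ->.
rewrite -addn1 => /word_ball_split[c [s [-> nc /word_ball1P Ss]]].
by rewrite addn1 => /= Ax; apply: (IH c (s x) nc); exact: Ax.
Qed.

Lemma invariant_part_generator_inter_iter (V : set X) (n : nat) :
  invariant_part (S := S) V `<=` iter n generator_inter V.
Proof.
elim: n => [|n IH] x Vx; first exact: invariant_part_sub Vx.
move=> s Ss; apply: IH => g Gg; apply: (Vx (g * s)).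
by apply: subgroup_generatedM => //; exact: sub_gen_smallest.
Qed.

(* If the intersection V_oo of the V_n is not open, the sequence V_n is not
   stationary, so that for every n some point of V_n leaves V only after n
   steps. The points from which such paths leave V accumulate at a point z of V
   which leaves V in one step but which can be moved into every V_n within V. *)
Lemma invariant_part_open (V : set X) : compact V -> open V ->
  (forall x y, V x -> invariant_part (S := S) V y ->
     closure (action_orbit G x) y -> closure (action_orbit G y) x) ->
  open (invariant_part (S := S) V).
Proof.
move=> cV oV symV; have clV := lczd_compact_closed Xlczd V cV.
set Vn := fun n => iter n generator_inter V.
have VnP n : [/\ clopen (Vn n), compact (Vn n) & Vn n `<=` V].
  exact: generator_inter_iter.
(* In the stationary case V_n is stable under [S], so it equals V_oo and is open. *)
have [[n VnS]|nst] := pselect (exists n, Vn n `<=` Vn n.+1).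
  have <- : Vn n = invariant_part (S := S) V.
    apply/seteqP; split; last exact: invariant_part_generator_inter_iter.
    by case: (VnP n) => _ _; exact: generator_inter_invariant VnS.
  by case: (VnP n) => -[].
(* The points of [V] from which k generator steps inside [V] can lead into V_m. *)
pose P m k := iter k (generator_union V) (Vn m).
have PP m k : clopen (P m k) /\ P m k `<=` V.
  elim: k => [|k [kclopen kV]]; first by case: (VnP m).
  split; last by move=> x [].
  apply: generator_union_clopen => //; last exact: kclopen.1.
  exact: subclosed_compact kclopen.2 cV kV.
have PS m : P m.+1 m.+1 `<=` P m m.
  rewrite /P iterSr; elim: {1 3}m => [|k IH] /=.
    by move=> x [_ [s Ss /(_ _ (SV s Ss))]]; rewrite homeo_mulK.
  exact: generator_union_mono.
(* Start in V_m but outside V_(m+1) and repeatedly apply a generator that leaves the current V_j: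
   each step lowers the level by exactly one, and the inverse generators lead back. *)
have PN0 m k : (k <= m)%N -> P m k `&` (Vn (m - k) `\` Vn (m - k).+1) !=set0.
  elim: k => [|k IH] km.
    rewrite subn0; have /existsNP[x /not_implyP[mx mSx]] : ~ Vn m `<=` Vn m.+1.
      by move=> mmS; apply: nst; exists m.
    by exists x.
  have [x [Px []]] := IH (ltnW km); rewrite -(subSS k m) subSn //.
  move=> Vx /existsNP[s /not_implyP[Ss nVsx]].
  have Vsx : Vn (m - k.+1)%N (s x) by exact: Vx.
  exists (s x); split; last by split.
  split; first by case: (VnP (m - k.+1)%N) => _ _; exact.
  by exists s^-1; [exact: SV|rewrite homeo_mulK].
(* At k = m the level is 0: these points lie in [V] but outside V_1. *)
have [z [Vz zP]] : V `&` \bigcap_m (P m m `\` Vn 1%N) !=set0.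
  apply: compact_decreasing_bigcap => // m.
  - rewrite setDE; apply: closedI; first by case: (PP m m) => -[].
    by apply: open_closedC; case: (VnP 1%N) => -[].
  - by move=> x [Px V1x]; split => //; exact: PS.
  - have := PN0 m m (leqnn m); rewrite subnn => -[x [Px [Vx V1x]]].
    by exists x.
have zVn m : exists2 g, G g & Vn m (g z).
  have {zP} [+ _] := zP m I; elim: {2}m z {Vz} => [|k IH] z.
    by exists 1 => //; exact: subgroup_generated1.
  move=> [_ [s Ss /IH[g Gg Vgsz]]]; exists (g * s) => //.
  by apply: subgroup_generatedM => //; exact: sub_gen_smallest.
(* The orbit of z enters every V_m, so by compactness its closure meets V_oo. *)
have [y [Vy yP]] : V `&` \bigcap_m (closure (action_orbit G z) `&` Vn m) !=set0.
  apply: compact_decreasing_bigcap => // m.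
  - by apply: closedI; [exact: closed_closure|case: (VnP m) => -[]].
  - by move=> x [zx VSx]; split => //; exact: generator_inter_sub.
  - have [g Gg Vgz] := zVn m; exists (g z); split.
      by case: (VnP m) => _ _; exact.
    by split => //; exact: orbit_closure_orbit.
have Vooy : invariant_part (S := S) V y.
  by apply: bigcap_generator_inter_iter => m _; case: (yP m I).
have [zy _] := yP 0%N I.
have yz := symV z y Vz Vooy zy.
have Vooz := orbit_closure_sub _ _ (invariant_part_closed _ clV)
  (@invariant_part_invariant _ _ V) Vooy _ yz.
by case: (zP 0%N I) => _ []; exact: (invariant_part_generator_inter_iter V 1).
Qed.

End EquicontinuousGenerators.

Lemma compact_set_val_preimage {X : topologicalType} (A C : set X) :
  compact C -> C `<=` A -> compact (set_val @^-1` C : set A).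
Proof.
move=> cC CA F FF FC.
have [x [Cx xcl]] := cC (set_val @ F) (fmap_proper_filter _ _) FC.
exists (exist _ x (mem_set (CA x Cx))); split=> //.
move=> M N FM [_ [[W Wop <-] Wx WN]].
have FM' : (set_val @ F) (set_val @` M).
  exact: filterS (@preimage_image _ _ set_val M) FM.
have [_ [[a Ma <-] Wa]] := xcl _ _ FM' (open_nbhs_nbhs (conj Wop Wx)).
by exists a; split => //; exact: WN.
Qed.

Section Equivalences.
Context {X : topologicalType} {S : set (homeo X)} {E : set_system (X * X)}.
Hypothesis Xlczd : locally_compact_zero_dimensional X.
Hypothesis S1 : S 1.
Hypothesis SV : forall s, S s -> S s^-1.
Hypothesis EX : compatible_uniformity E.
Hypothesis ES : equicontinuous_wrt E S.
Local Notation G := (subgroup_generated S).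
Context {U : set X}.
Hypothesis oU : open U.
Local Notation Ustar := (compact_core G U).

Let orbit_symmetric := forall x y : X, U x -> Ustar y ->
  closure (action_orbit G x) y -> closure (action_orbit G y) x.

Let open_invariant_parts := forall V : set X,
  compact V -> open V -> V `<=` U -> open (invariant_part (S := S) V).

Lemma core_orbit_closure (x : X) : Ustar x ->
  compact (closure (action_orbit G x)) /\
  closure (action_orbit G x) `<=` Ustar.
Proof.
move=> [K [cK Kinv KU] Kx].
have clK := lczd_compact_closed Xlczd K cK.
have xK := orbit_closure_sub K x clK Kinv Kx.
split; first exact: subclosed_compact (@closed_closure _ _) cK xK.
by move=> y /xK Ky; exists K.
Qed.

Lemma core_of_orbit_closure (x y : X) : open Ustar -> Ustar y ->
  closure (action_orbit G x) y -> Ustar x.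
Proof.
move=> oUs Uy /(_ _ (open_nbhs_nbhs (conj oUs Uy)))[_ [[g Gg <-]]].
exact: compact_coreMP.
Qed.

Lemma S_recurrent_orbit_symmetric : open Ustar ->
  (forall x, Ustar x -> S_recurrent S x) -> orbit_symmetric.
Proof.
move=> oUs Urec x y Ux Uy xy; have Usx := core_of_orbit_closure x y oUs Uy xy.
apply: contrapT => /(closureNP _ _ Xlczd)[N [_ oN Nx yN]].
have [L [cL oL Lx]] := compact_open_nbhs Xlczd x _
  (open_nbhs_nbhs (conj (openI oN oUs) (conj Nx Usx))).
rewrite subsetI => -[LN LU].
have [n nP] := S_recurrent_uniform_return S1 SV EX ES U L cL oL LU
  (fun z Lz => Urec z (LU z Lz)).
have [_ [[g Gg <-] yg]] :=
  xy _ (compact_core_near_word_ball S1 EX ES U L n y Uy cL oL).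
have [h nh Lhgx] := nP x g Lx Gg.
apply: (yN (h y)); first by exists h => //; exact: word_ball_sub nh.
exact/LN/(yg h nh).
Qed.

Lemma almost_periodic_orbit_symmetric : open Ustar ->
  (forall x, Ustar x -> almost_periodic G x) -> orbit_symmetric.
Proof.
move=> oUs Uap x y Ux Uy xy; have Usx := core_of_orbit_closure x y oUs Uy xy.
apply: contrapT => /(closureNP _ _ Xlczd)[N [cN oN Nx yN]].
have [F [/finite_seqP[A FA] FG FM]] :=
  Uap x Usx N (open_nbhs_nbhs (conj oN Nx)).
have clF : closed (\big[setU/set0]_(f <- A) [set z | N (homeo_inv f z)]).
  apply: closed_bigsetU => f _; apply: preimage_closed.
    by move=> z _; exact: homeo_inv_continuous.
  exact: lczd_compact_closed Xlczd N cN.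
have : (\big[setU/set0]_(f <- A) [set z | N (homeo_inv f z)]) y.
  apply: clF; move: xy; apply: closureS => _ [g Gg <-].
  move: Gg; rewrite -FM => -[f Ff [m [_ Nmx] <-]].
  rewrite -bigcup_seq; exists f; first by move: Ff; rewrite FA.
  exact: (eq_ind_r N Nmx (homeoK f (m x))).
rewrite -bigcup_seq => -[f Af Nfy].
apply: (yN (f^-1 y)) => //; exists f^-1 => //.
by apply: subgroup_generatedV; apply: FG; rewrite FA.
Qed.

Lemma orbit_symmetric_almost_periodic : open Ustar -> orbit_symmetric ->
  forall x, Ustar x -> almost_periodic G x.
Proof.
move=> oUs Usym x Ux N Nx; have [cx xU] := core_orbit_closure x Ux.
move: Nx; rewrite nbhsE => -[W [Wop Wx] WN].
have [||A _|y xy|F [Ffin FG] xF] := @compact_directed_cover X _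
  [set F | finite_set F /\ F `<=` G] (fun F => \bigcup_(f in F) f @^-1` W)
  _ cx.
- by exists set0; split.
- move=> F1 F2 [F1fin F1G] [F2fin F2G]; exists (F1 `|` F2).
    by split; [rewrite finite_setU|rewrite subUset].
  by rewrite bigcup_setU.
- apply: bigcup_open => f _; apply: open_comp => // z _.
  exact: homeo_continuous.
- have /(_ _ (open_nbhs_nbhs (conj Wop Wx)))[_ [[g Gg <-] Wgy]] :=
    Usym x y (compact_core_sub _ _ Ux) (xU y xy) xy.
  exists [set g] => /=; last by exists g.
  by split; [exact: finite_set1|move=> _ ->].
exists [set f^-1 | f in F]; split; first exact: finite_image.
  by move=> _ [f Ff <-]; apply: subgroup_generatedV; exact: FG.
apply/seteqP; split=> [_ [_ [f Ff <-] [m [Gm _] <-]]|g Gg].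
  by apply: subgroup_generatedM => //; apply: subgroup_generatedV; exact: FG.
have [f Ff Wfgx] := xF _ (orbit_closure_orbit x g Gg).
exists f^-1; first by exists f.
exists (f * g); last by rewrite mulKg.
by split; [apply: subgroup_generatedM => //; exact: FG|exact: WN].
Qed.

Lemma orbit_symmetric_open_invariant_parts :
  orbit_symmetric -> open_invariant_parts.
Proof.
move=> Usym V cV oV VU.
apply: (invariant_part_open Xlczd S1 SV EX ES) => // x y Vx Vy.
apply: Usym; first exact: VU.
exact: invariant_part_core (lczd_compact_closed Xlczd V cV) cV VU y Vy.
Qed.

Section OpenInvariantParts.
Hypothesis oinv : open_invariant_parts.

Lemma open_compact_core : open Ustar.
Proof.
rewrite openE => x /(compact_coreP U x Xlczd oU)[V [cV oV VU Vx]].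
apply: filterS (open_nbhs_nbhs (conj (oinv V cV oV VU) Vx)).
exact: invariant_part_core (lczd_compact_closed Xlczd V cV) cV VU.
Qed.

Lemma orbit_closure_basis (x : X) (W : set X) : Ustar x -> open W ->
  closure (action_orbit G x) `<=` W ->
  exists C, [/\ compact C, open C, invariant_set G C, C x & C `<=` W `&` Ustar].
Proof.
move=> Ux Wop xW; have [cx xU] := core_orbit_closure x Ux.
have [|V [cV oV xV VWU]] := compact_open_between Xlczd _ _ cx (openI Wop oU).
  by rewrite subsetI; split => // y /xU/compact_core_sub.
have VW := subset_trans VWU (@subIsetl _ W U).
have VU := subset_trans VWU (@subIsetr _ W U).
have clV := lczd_compact_closed Xlczd V cV.
exists (invariant_part (S := S) V); split.
- exact: invariant_part_compact.
- exact: oinv.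
- exact: invariant_part_invariant.
- by move=> g Gg; exact/xV/orbit_closure_orbit.
- rewrite subsetI; split; last exact: invariant_part_core.
  exact: subset_trans (@invariant_part_sub _ _ V) VW.
Qed.

Lemma orbit_closure_separation (x y : X) :
  Ustar x -> ~ closure (action_orbit G x) y ->
  exists C, [/\ compact C, open C, invariant_set G C, C x & C `<=` Ustar `\ y].
Proof.
move=> Ux xy; have [_ hX _] := Xlczd.
have [|z xz zy|C [cC oC Cinv Cx]] := orbit_closure_basis x (~` [set y]) Ux.
- apply: closed_openC; apply: accessible_closed_set1.
  exact: hausdorff_accessible.
- by apply: xy; rewrite -zy.
- by rewrite setIC => CU; exists C.
Qed.

Lemma open_invariant_parts_orbit_symmetric : orbit_symmetric.
Proof.
move=> x y Ux Uy xy; apply: contrapT => /(orbit_closure_separation y x Uy).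
move=> [C [_ oC /invariant_setP Cinv Cy CU]].
have [_ [[g Gg <-] Cgx]] := xy _ (open_nbhs_nbhs (conj oC Cy)).
have := Cinv _ _ (subgroup_generatedV Gg) Cgx.
by rewrite homeo_mulK => /CU[_]; exact.
Qed.

Lemma open_invariant_parts_closed_rel : exists W : set X,
  [/\ open W, Ustar `<=` W
    & closed [set p : W * W |
                orbit_closure_rel G (set_val p.1) (set_val p.2)]].
Proof.
exists Ustar; split => //; first exact: open_compact_core.
rewrite -openC openE => -[x y] /= xy.
have [C [cC oC Cinv Cx CU]] :=
  orbit_closure_separation _ _ (set_valP x) xy.
have clC := lczd_compact_closed Xlczd C cC.
exists (set_val @^-1` C, set_val @^-1` ~` C); first split => /=.
- by apply: open_nbhs_nbhs; split => //; exists C.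
- apply: open_nbhs_nbhs; split.
    by exists (~` C) => //; exact: closed_openC.
  by move=> /CU[_]; exact.
- by move=> [u v] [/= Cu nCv] /(orbit_closure_sub _ _ clC Cinv Cu).
Qed.

End OpenInvariantParts.

Lemma closed_rel_orbit_symmetric (W : set X) : open W -> Ustar `<=` W ->
  closed [set p : W * W | orbit_closure_rel G (set_val p.1) (set_val p.2)] ->
  orbit_symmetric.
Proof.
move=> Wop UW clR x y Ux Uy xy.
have Wy := UW y Uy.
have [_ [[g Gg <-] Wgx]] := xy _ (open_nbhs_nbhs (conj Wop Wy)).
have : orbit_closure_rel G y (g x).
  apply: (clR (exist _ y (mem_set Wy), exist _ (g x) (mem_set Wgx))).
  move=> B [[B1 B2] /= [[_ [[V1 V1op <-] V1y V1B]] B2gx] BB].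
  have [_ [[h Gh <-] [Whx V1hx]]] :=
    xy _ (open_nbhs_nbhs (conj (openI Wop V1op) (conj Wy V1y))).
  exists (exist _ (h x) (mem_set Whx), exist _ (g x) (mem_set Wgx)).
  split; last first.
    by apply: BB; split; [exact: V1B|exact: nbhs_singleton].
  rewrite /= /orbit_closure_rel action_orbitM //.
  exact: orbit_closure_orbit.
move=> /orbit_closure_trans; apply.
rewrite action_orbitM //; exact: orbit_closure_refl.
Qed.

Lemma quotient_orbit_symmetric (Y : topologicalType) (phi : Ustar -> Y) :
  open Ustar -> hausdorff_space Y -> quotient_map phi ->
  equivariant_map G (@trivial_action X Y) phi ->
  (forall y : Y, minimal_on G [set set_val x | x in phi @^-1` [set y]]) ->
  orbit_symmetric.
Proof.
move=> oUs hY [_ phiq] phiG phimin x y Ux Uy xy.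
have Usx := core_of_orbit_closure x y oUs Uy xy.
pose a : Ustar := exist _ x (mem_set Usx).
pose b : Ustar := exist _ y (mem_set Uy).
have phiab : phi a = phi b.
  apply: contrapT => ab.
  have /phiq[W Wop WE] : open (~` [set phi a]).
    apply: closed_openC; apply: accessible_closed_set1.
    exact: hausdorff_accessible.
  have Wy : W y.
    have : (phi @^-1` (~` [set phi a])) b by move=> /= /esym.
    by rewrite -WE.
  have [_ [[g Gg <-] Wgx]] := xy _ (open_nbhs_nbhs (conj Wop Wy)).
  pose ga : Ustar := exist _ (g x) (mem_set (compact_coreM U x g Gg Usx)).
  have : (phi @^-1` (~` [set phi a])) ga by rewrite -WE.
  by apply; exact: (phiG g a ga Gg erefl).
pose A := [set set_val x | x in phi @^-1` [set phi b]].
have Ax : A x by exists a.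
have Ay : A y by exists b.
move=> N; rewrite nbhsE => -[W [Wop Wx] WN].
have [||z [Wz yz]] := phimin (phi b) (exist _ y (mem_set Ay)) (set_val @^-1` W).
- by exists (exist _ x (mem_set Ax)).
- by exists W.
- by exists (set_val z); split; [exact: yz|exact: WN].
Qed.

End Equivalences.

Section OrbitClosureQuotient.
Context {X : topologicalType} {S : set (homeo X)}.
Hypothesis Xlczd : locally_compact_zero_dimensional X.
Local Notation G := (subgroup_generated S).
Context {U : set X}.
Hypothesis oU : open U.
Local Notation Ustar := (compact_core G U).
Hypothesis oinv : forall V : set X,
  compact V -> open V -> V `<=` U -> open (invariant_part (S := S) V).

Local Open Scope quotient_scope.

Let same_orbit_closure (a b : Ustar) :=
  `[< closure (action_orbit G (set_val a)) (set_val b) >].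

Let same_orbit_closure_refl : reflexive same_orbit_closure.
Proof. by move=> a; apply/asboolP; exact: orbit_closure_refl. Qed.

Let same_orbit_closure_sym : symmetric same_orbit_closure.
Proof.
have sym a b : same_orbit_closure a b -> same_orbit_closure b a.
  move=> /asboolP ab; apply/asboolP.
  apply: (open_invariant_parts_orbit_symmetric Xlczd oU oinv) ab.
    exact: compact_core_sub (set_valP a).
  exact: set_valP.
by move=> a b; apply/idP/idP; exact: sym.
Qed.

Let same_orbit_closure_trans : transitive same_orbit_closure.
Proof.
move=> b a c /asboolP ab /asboolP bc; apply/asboolP.
exact: orbit_closure_trans ab bc.
Qed.

Let same_orbit_closure_equiv := EquivRel same_orbit_closure
  same_orbit_closure_refl same_orbit_closure_sym same_orbit_closure_trans.

Let Y := quotient_topology {eq_quot same_orbit_closure_equiv}.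

Let phi (a : Ustar) : Y := \pi_Y a.

Let phiE (a b : Ustar) :
  phi a = phi b <-> closure (action_orbit G (set_val a)) (set_val b).
Proof.
split=> [/eqquotP/asboolP//|ab]; apply/eqquotP; exact/asboolP.
Qed.

Let phi_surj (y : Y) : exists a, phi a = y.
Proof. by exists (repr y); exact: reprK. Qed.

Let phi_quotient : quotient_map phi.
Proof.
split; last by move=> V; split.
by apply/seteqP; split => // y _; have [a <-] := phi_surj y; exists a.
Qed.

Let phi_preimage_image (C : set X) : closed C -> invariant_set G C ->
  phi @^-1` (phi @` (set_val @^-1` C)) = set_val @^-1` C.
Proof.
move=> clC Cinv; apply/seteqP; split; last exact: preimage_image.
move=> a [b Cb /phiE ba].
exact: orbit_closure_sub clC Cinv Cb _ ba.
Qed.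

Let phi_image_clopen (C : set X) : compact C -> open C -> invariant_set G C ->
  clopen (phi @` (set_val @^-1` C)).
Proof.
move=> cC oC Cinv; have clC := lczd_compact_closed Xlczd C cC.
split; first by apply/phi_quotient.2; rewrite phi_preimage_image //; exists C.
rewrite -openC; apply/phi_quotient.2.
rewrite -preimage_setC phi_preimage_image //.
by exists (~` C) => //; exact: closed_openC.
Qed.

Let phi_image_compact (C : set X) : compact C -> C `<=` Ustar ->
  compact (phi @` (set_val @^-1` C)).
Proof.
move=> cC CU; apply: continuous_compact.
  by apply: continuous_subspaceT; exact: pi_continuous.
exact: compact_set_val_preimage.
Qed.

Let quotient_basis (a : Ustar) (N : set Y) : nbhs (phi a) N ->
  exists D : set Y, [/\ compact D, clopen D, D (phi a) & D `<=` N].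
Proof.
rewrite nbhsE => -[V [[W Wop WE] Va] VN].
have [|C [cC oC Cinv Ca CU]] :=
    orbit_closure_basis Xlczd oU oinv (set_val a) W (set_valP a) Wop.
  move=> z az; have [_ /(_ z az) Uz] := core_orbit_closure Xlczd _ (set_valP a).
  pose c : Ustar := exist _ z (mem_set Uz).
  have : (phi @^-1` V) c by rewrite /= -(phiE a c).2.
  by rewrite -WE.
exists (phi @` (set_val @^-1` C)); split.
- by apply: phi_image_compact => // z /CU[].
- exact: phi_image_clopen.
- by exists a.
- move=> _ [c Cc <-]; apply: VN.
  have : (set_val @^-1` W) c by case: (CU _ Cc).
  by rewrite WE.
Qed.

Let quotient_lczd : locally_compact_zero_dimensional Y.
Proof.
split.
- move=> y _; have [a <-] := phi_surj y.
  have [D [cD [oD clD] Da _]] := quotient_basis a setT filterT.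
  exists D; last by split.
  by rewrite withinET; exact: open_nbhs_nbhs.
- rewrite open_hausdorff => y z; have [a <-] := phi_surj y.
  have [b <-] := phi_surj z => /eqP ab.
  have [C [cC oC Cinv Ca CU]] := orbit_closure_separation Xlczd oU oinv
    _ (set_val b) (set_valP a) (fun ba => ab ((phiE a b).2 ba)).
  have clC := lczd_compact_closed Xlczd C cC.
  have [oD clD] := phi_image_clopen C cC oC Cinv.
  exists (phi @` (set_val @^-1` C), ~` (phi @` (set_val @^-1` C))).
    rewrite !inE; split => /=; first by exists a.
    move=> [c Cc /phiE cb].
    by have [_] := CU _ (orbit_closure_sub _ _ clC Cinv Cc _ cb); exact.
  by split => //=; [exact: closed_openC|rewrite setICr].
- exists (@clopen Y) => //; split; first by move=> D [].
  move=> y N; have [a <-] := phi_surj y => /quotient_basis[D [_ cD Da DN]].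
  by exists D.
Qed.

Let phi_equivariant : equivariant_map G (@trivial_action X Y) phi.
Proof.
move=> g a ga Gg gaE; apply/esym/phiE; rewrite gaE.
exact: orbit_closure_orbit.
Qed.

Let phi_minimal (y : Y) :
  minimal_on G [set set_val x | x in phi @^-1` [set y]].
Proof.
move=> [x xA] V [[z zA] Vz] [W Wop WE].
have := Vz; rewrite -WE => /= Wz.
have [b /= by_ bz] := set_mem zA; have [a /= ay ax] := set_mem xA.
have /phiE : phi a = phi b by rewrite by_ ay.
rewrite ax bz => /(_ W (open_nbhs_nbhs (conj Wop Wz)))[_ [[g Gg <-] Wgx]].
have Agx : [set set_val x | x in phi @^-1` [set y]] (g x).
  have Uax : Ustar (g (set_val a)).
    by apply: compact_coreM => //; exact: set_valP.
  pose ga : Ustar := exist _ (g (set_val a)) (mem_set Uax).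
  exists ga => /=; last by rewrite -ax.
  by rewrite (phi_equivariant g a ga Gg erefl).
exists (exist _ (g x) (mem_set Agx)); split; last by exists g.
exact: Wgx.
Qed.

Lemma orbit_closure_quotient :
  exists (Y : topologicalType) (phi : Ustar -> Y),
    [/\ locally_compact_zero_dimensional Y, quotient_map phi,
        equivariant_map G (@trivial_action X Y) phi
      & forall y : Y, minimal_on G [set set_val x | x in phi @^-1` [set y]]].
Proof. by exists Y, phi; split. Qed.

End OrbitClosureQuotient.

Theorem theorem1p3 (X : topologicalType) (S : set (homeo X)) (U : set X) :
  locally_compact_zero_dimensional X ->
  S 1 -> S = [set s^-1 | s in S] ->
  (exists E : set_system (X * X),
     compatible_uniformity E /\ equicontinuous_wrt E S) ->
  open U ->
  let G := subgroup_generated S in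
  let Ustar := compact_core G U in
  [<-> open Ustar /\ (forall x, Ustar x -> S_recurrent S x);
       open Ustar /\ (forall x, Ustar x -> almost_periodic G x);
       forall V : set X, compact V -> open V -> V `<=` U ->
         open (\bigcap_(g in G) [set g x | x in V]);
       forall x y : X, U x -> Ustar y ->
         closure (action_orbit G x) y -> closure (action_orbit G y) x;
       exists W : set X, [/\ open W, Ustar `<=` W
         & closed [set p : W * W |
                     orbit_closure_rel G (set_val p.1) (set_val p.2)]];
       open Ustar /\
       exists (Y : topologicalType) (phi : Ustar -> Y),
         [/\ locally_compact_zero_dimensional Y,
             quotient_map phi,
             equivariant_map G (@trivial_action X Y) phi
           & forall y : Y,
               minimal_on G [set set_val x | x in phi @^-1` [set y]]]].
Proof.
move=> Xlczd S1 SE [E [EX ES]] oU G Ustar.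
have SV s : S s -> S s^-1 by move=> Ss; rewrite SE; exists s.
have sym_oinv := orbit_symmetric_open_invariant_parts Xlczd S1 SV EX ES
  (U := U).
have sym_open sym := open_compact_core Xlczd oU (sym_oinv sym).
have sym_ap sym :=
  orbit_symmetric_almost_periodic Xlczd (sym_open sym) sym.
tfae.
- move=> [oUs Urec].
  have sym := S_recurrent_orbit_symmetric Xlczd S1 SV EX ES oUs Urec.
  by split => //; exact: sym_ap.
- move=> [oUs Uap] V.
  rewrite invariant_partE; move: V; apply: sym_oinv.
  exact (almost_periodic_orbit_symmetric Xlczd oUs Uap).
- move=> oinv; apply: (open_invariant_parts_orbit_symmetric Xlczd oU) => V.
  by rewrite -invariant_partE; exact: oinv.
- by move=> /sym_oinv; exact: open_invariant_parts_closed_rel.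
- move=> [W [Wop UW clR]].
  have sym := closed_rel_orbit_symmetric W Wop UW clR.
  by split; [exact: sym_open|exact: orbit_closure_quotient (sym_oinv sym)].
- move=> [oUs [Y [phi [[_ hY _] phiq phiG phimin]]]].
  have sym := quotient_orbit_symmetric Y phi oUs hY phiq phiG phimin.
  split => // x Ux; apply: (almost_periodic_S_recurrent SV).
  exact: sym_ap.
Qed.
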